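(* There exist infinitely many block-transitive, $3$-grid-imprimitive $2$-designs, and at least one block-transitive, $4$-grid-imprimitive $2$-design.
   Context: A $2$-design, or $2$-$(v,k,\lambda)$ design, is an incidence structure with a finite set $\mathcal{P}$ of $v$ points and a set of blocks, each a $k$-subset of $\mathcal{P}$, such that every pair of distinct points is contained in exactly $\lambda$ blocks, for a constant $\lambda$. A permutation group $H$ on a finite set $\mathcal{P}$ is $s$-grid-imprimitive, where $s\ge2$, if $\mathcal{P}$ can be identified with a Cartesian product $\mathcal{E}_1\times\cdots\times\mathcal{E}_s$ with $|\mathcal{E}_i|>1$ for all $i$, in such a way that $H\le \mathrm{Sym}(\mathcal{E}_1)\times\cdots\times\mathrm{Sym}(\mathcal{E}_s)$ acting coordinatewise, $(\delta_1,\dots,\delta_s)^{(g_1,\dots,g_s)}=(\delta_1^{g_1},\dots,\delta_s^{g_s})$. A $2$-design is called block-transitive, $s$-grid-imprimitive if it admits a group $H$ of automorphisms that is transitive on the set of blocks and whose action on points is $s$-grid-imprimitive. *)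

(* Defs.v *)
From HB Require Import structures.
From mathcomp Require Import all_boot all_fingroup.

Set Implicit Arguments.
Unset Strict Implicit.
Unset Printing Implicit Defensive.

Record design2 := Design2 {
  point : finType;
  block_size : nat;
  lambda : nat;
  blocks : {set {set point}};
  card_block : forall B : {set point}, B \in blocks -> #|B| = block_size;
  card_blocks_through : forall x y : point, x != y ->
    #|[set B in blocks | (x \in B) && (y \in B)]| = lambda
}.

(* The bare axioms admit the designs consisting of all k-subsets, and designs
   with no pair in any block (lambda = 0).  Designs of these kinds exist
   trivially on every grid, with a block-transitive coordinatewise group: for
   instance k = v, k = v - 1, or a single one-point block.  This predicate is
   the usual convention that excludes them. *)
Definition nontrivial (D : design2) : Prop :=
  [/\ 0 < lambda D,
      2 < block_size D < #|point D|
    & exists2 B : {set point D}, #|B| = block_size D & B \notin blocks D].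

Definition isomorphic (D1 D2 : design2) : Prop :=
  exists2 f : point D1 -> point D2, bijective f &
    [set f @: (B : {set point D1}) | B in blocks D1] = blocks D2.

(* 'P^* is the action of permutations of the points on sets of points. *)
Definition automorphism_group (D : design2) (H : {group {perm point D}}) : Prop :=
  [acts H, on blocks D | 'P^*].

Definition block_transitive (D : design2) (H : {group {perm point D}}) : Prop :=
  [transitive H, on blocks D | 'P^*].

Definition grid_imprimitive (s : nat) (P : finType) (H : {group {perm P}}) : Prop :=
  1 < s /\
  exists E : 'I_s -> finType,
    (forall i : 'I_s, 1 < #|E i|) /\
    exists2 f : P -> {dffun forall i : 'I_s, E i}, bijective f &
      forall h : {perm P}, h \in H ->
        exists g : forall i : 'I_s, {perm E i},
          forall (x : P) (i : 'I_s), f (h x) i = g i (f x i).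

Definition block_transitive_grid_imprimitive (s : nat) (D : design2) : Prop :=
  exists H : {group {perm point D}},
    [/\ automorphism_group H, block_transitive H & grid_imprimitive s H].

(* Main.v *)
Require Import Defs.
From HB Require Import structures.
From mathcomp Require Import all_boot all_fingroup.
From mathcomp Require Import ssralg ssrint finalg zmodp zify.

(* A difference set D in a finite abelian group yields a 2-design, the
   translates of D, on which the group of translations is block-transitive.
   If the group is a direct product, translations act coordinatewise on it, so
   it only remains to find difference sets in large direct products.  These
   come from Menon's product construction: D is a difference set with
   4 lambda = 4 k - v as soon as the function x |-> (-1)^[x \in D] has zero
   autocorrelation at every nonzero shift; this holds for {0} in Z_4, and is
   preserved by taking pointwise products of functions over direct products of
   groups. *)

Set Implicit Arguments.
Unset Strict Implicit.
Unset Printing Implicit Defensive.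

Import GRing.Theory.

(** Registering the pointwise group structure again lets it join the finite type structure, so that
    function spaces, also iterated ones, are [finZmodType]s. *)
HB.instance Definition _ (I : finType) (A : finZmodType) :=
  GRing.Zmodule.on {ffun I -> A}.

(** * Sets with vanishing sign autocorrelation *)

Section MenonSets.

Local Open Scope ring_scope.

Definition sign_fun (T : finType) (D : {set T}) (x : T) : int :=
  (-1) ^+ (x \in D).

Definition menon (A : finZmodType) (D : {set A}) : Prop :=
  forall d, d != 0 -> \sum_x sign_fun D x * sign_fun D (x + d) = 0.

Lemma sum_sign_fun (T : finType) (D : {set T}) :
  \sum_x sign_fun D x = #|T|%:Z - (#|D| * 2)%:Z.
Proof.
have signE x : sign_fun D x = 1 - (x \in D)%:R *+ 2.
  by rewrite /sign_fun; case: (x \in D).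
rewrite (eq_bigr _ (fun x _ => signE x)) sumrB sumrMnl -natr_sum -sum1_card.
rewrite -big_mkcond sum1_card sumr_const cardT -cardE; lia.
Qed.

(** The product of [1 - sign_fun D x] and [1 - sign_fun D (x + d)] is 4 if both points lie in [D]
    and 0 otherwise; expand it and sum over [x]. *)
Lemma menon_card_meet (A : finZmodType) (D : {set A}) (d : A) :
  menon D -> d != 0 ->
  (4 * #|[set x in D | (x + d)%R \in D]| + #|A| = 4 * #|D|)%N.
Proof.
move=> menonD d_neq0.
have sum_shift : \sum_x sign_fun D (x + d) = \sum_x sign_fun D x.
  by rewrite [RHS](reindex_inj (addIr d)).
have: \sum_x (1 - sign_fun D x) * (1 - sign_fun D (x + d)) =
      (4 * #|[set x in D | (x + d)%R \in D]|)%N%:Z.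
  rewrite -sum1_card big_distrr /= -[RHS]natz natr_sum [RHS]big_mkcond /=.
  apply: eq_bigr => x _; rewrite inE /sign_fun.
  by case: (x \in D); case: (x + d \in D).
under eq_bigr => x _ do rewrite mulrBr mulr1 mulrBl mul1r.
rewrite !sumrB menonD // sum_shift sumr_const cardT -cardE sum_sign_fun natz.
by move: #|A| #|D| #|finset _| => *; lia.
Qed.

Definition odd_power (I T : finType) (D : {set T}) : {set {ffun I -> T}} :=
  [set x : {ffun I -> T} | \big[addb/false]_i (x i \in D)].

Lemma sign_fun_odd_power (I T : finType) (D : {set T}) (x : {ffun I -> T}) :
  sign_fun (odd_power I D) x = \prod_i sign_fun D (x i).
Proof.
rewrite /sign_fun inE.
by apply: (big_morph (fun b : bool => (-1) ^+ b)) => // b c; rewrite signr_addb.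
Qed.

Lemma sum_sign_fun_odd_power (I T : finType) (D : {set T}) :
  \sum_x sign_fun (odd_power I D) x = (\sum_x sign_fun D x) ^+ #|I|.
Proof.
under eq_bigr => x _ do rewrite sign_fun_odd_power.
by rewrite -(bigA_distr_bigA (fun _ => sign_fun D)) prodr_const cardT -cardE.
Qed.

(** The autocorrelation at [d] factors into those of [D] at the coordinates [d i], and one nonzero
    [d i] kills the product. *)
Lemma menon_odd_power (I : finType) (A : finZmodType) (D : {set A}) :
  menon D -> menon (odd_power I D).
Proof.
move=> menonD d d_neq0.
have [i di_neq0] : exists i, d i != 0.
  apply/existsP; apply: contraNT d_neq0 => /existsPn d0.
  by apply/eqP/ffunP => i; rewrite ffunE; apply/eqP; rewrite -[_ == _]negbK.
under eq_bigr => x _.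
  rewrite !sign_fun_odd_power -big_split /=.
  under eq_bigr => j _ do rewrite ffunE.
  over.
rewrite -(bigA_distr_bigA (fun j y => sign_fun D y * sign_fun D (y + d j))).
by rewrite (bigD1 i) //= menonD // mul0r.
Qed.

(** For [d != 0] the two terms [x = 0] and [x = - d] are -1, the other two are 1. *)
Lemma menon_Z4 : menon [set 0 : 'Z_4].
Proof.
move=> d; rewrite !big_ord_recl big_ord0 /sign_fun !inE.
by case: d => [[|[|[|[|]]]]].
Qed.

Lemma sum_sign_fun_Z4 : \sum_x sign_fun [set 0 : 'Z_4] x = 2.
Proof. by rewrite sum_sign_fun cards1 card_ord. Qed.

End MenonSets.

(** * The design of translates of a difference set *)

Section Translates.

Local Open Scope ring_scope.

Variables (A : finZmodType) (D : {set A}).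

Definition translation (t : A) : {perm A} := perm (@addIr A t).

Lemma mem_translate t x : (x \in translation t @: D) = (x - t \in D).
Proof.
apply/imsetP/idP => [[y Dy ->]|Dxt]; first by rewrite permE addrK.
by exists (x - t); rewrite // permE subrK.
Qed.

Definition translation_set : {set {perm A}} := [set translation t | t in A].

Lemma translation_group_set : group_set translation_set.
Proof.
apply/group_setP; split=> [|_ _ /imsetP[t _ ->] /imsetP[u _ ->]]; apply/imsetP.
  by exists 0 => //; apply/permP => x; rewrite perm1 permE addr0.
by exists (t + u) => //; apply/permP => x; rewrite permM !permE addrA.
Qed.

Canonical translation_group := Group translation_group_set.

Definition translates : {set {set A}} :=
  [set translation t @: D | t in A].

Lemma translates_transitive :
  [transitive translation_group, on translates | 'P^*].
Proof.
(* Transitivity unfolds to [translates] being the orbit of one of its members. *)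
apply/imsetP; exists D.
  apply/imsetP; exists 0 => //; apply/setP => x.
  by rewrite mem_translate subr0.
by rewrite /orbit /translation_group /= /translation_set -imset_comp.
Qed.

Hypothesis menonD : menon D.
Hypothesis card_lt4 : (#|A| < 4 * #|D|)%N.
Hypothesis card_D_lt : (#|D| < #|A|)%N.

Lemma meet_translate t : [set x in D | x + - t \in D] = D :&: translation t @: D.
Proof. by apply/setP => x; rewrite !inE mem_translate. Qed.

(** If two translates agree, [D] is invariant under [t - u], so it meets its shift in all of [D],
    forcing [#|A| = 0]. *)
Lemma translate_inj : injective (fun t => translation t @: D).
Proof.
move=> t u eqD; apply/eqP; rewrite -subr_eq0; apply: contraT => tu_neq0.
have:= menon_card_meet menonD tu_neq0.
suff -> : [set x in D | x + (t - u) \in D] = D by lia.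
apply/setP => x; rewrite inE andb_idr // => Dx.
by move/setP: eqD => /(_ (x + t)); rewrite !mem_translate addrK Dx addrA.
Qed.

(** A block through [x] and [y] is determined by the point [z] of [D] that is moved to [x]; then
    [z + (y - x)] is moved to [y]. The division by 4 is exact by [menon_card_meet]. *)
Lemma card_translates_through x y :
  x != y ->
  #|[set B in translates | (x \in B) && (y \in B)]| = (#|D| - #|A| %/ 4)%N.
Proof.
move=> x_neq_y; have yx_neq0 : y - x != 0 by rewrite subr_eq0 eq_sym.
have:= menon_card_meet menonD yx_neq0.
set M := finset _ => cardM; have -> : (#|D| - #|A| %/ 4)%N = #|M| by lia.
have -> : [set B in translates | (x \in B) && (y \in B)] =
          (fun z => translation (x - z) @: D) @: M.
  apply/setP => B; apply/setIdP/imsetP => [[/imsetP[t _ ->]]|[z]].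
    rewrite !mem_translate => /andP[Dx Dy]; exists (x - t).
      by rewrite inE Dx addrC addrA subrK.
    by rewrite subKr.
  rewrite inE => /andP[Dz Dy] ->; split; first exact: imset_f.
  by rewrite !mem_translate subKr Dz /= opprB addrCA.
by apply: card_imset => z w /translate_inj/addrI/oppr_inj.
Qed.

Definition translate_design : design2.
refine (@Design2 A #|D| (#|D| - #|A| %/ 4) translates _ card_translates_through).
by move=> _ /imsetP[t _ ->]; apply: card_imset perm_inj.
Defined.

Lemma translate_design_nontrivial :
  (4 < #|A|)%N -> (2 < #|D|)%N -> nontrivial translate_design.
Proof.
move=> card_gt4 D_gt2.
have lambda_gt0 : (0 < #|D| - #|A| %/ 4)%N by lia.
split; [exact: lambda_gt0 | exact/andP |].
have [x Dx] : exists x, x \in D by apply/card_gt0P; lia.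
have [y Dy] : exists y, y \in ~: D.
  by apply/card_gt0P; rewrite cardsCs setCK subn_gt0.
change (exists2 B : {set A}, #|B| = #|D| & B \notin translates).
rewrite inE in Dy.
have cardDx : (#|D :\ x| = #|D|.-1)%N by rewrite (cardsD1 x D) Dx.
have Dxy : y \notin D :\ x by rewrite !inE negb_and Dy orbT.
exists (y |: D :\ x); first by rewrite cardsU1 Dxy cardDx; lia.
apply/negP => /imsetP[t _ eqB].
(* Two distinct blocks meet in only lambda points, whereas D meets the set
   obtained by exchanging x and y in k - 1 points. *)
have t_neq0 : - t != 0.
  apply: contraNneq Dy => t0; have: y \in translation t @: D by rewrite -eqB setU11.
  by rewrite mem_translate t0 addr0.
have:= menon_card_meet menonD t_neq0; rewrite meet_translate -eqB.
(* A meet of size k - 1 in 4 lambda = 4 k - v would give v = 4. *)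
suff -> : D :&: (y |: D :\ x) = D :\ x by rewrite cardDx; lia.
apply/setP => z; rewrite !inE; have [->|_] := eqVneq z y.
  by rewrite (negPf Dy) andbF.
by case: (z \in D); rewrite ?andbF.
Qed.

End Translates.

(** * Designs on grids of powers of Z_4 *)

Section MenonGrid.

Local Open Scope ring_scope.

Variables s n : nat.
Hypothesis s_gt1 : (1 < s)%N.

(** The exponent [n.+1] keeps each axis nontrivial, while [n] indexes an infinite family. *)
Local Notation axis := {ffun 'I_n.+1 -> 'Z_4}.

Definition grid_set : {set {ffun 'I_s -> axis}} :=
  odd_power 'I_s (odd_power 'I_n.+1 [set 0 : 'Z_4]).

Lemma menon_grid_set : menon grid_set.
Proof. by do 2!apply: menon_odd_power; apply: menon_Z4. Qed.

Lemma card_grid : #|{ffun 'I_s -> axis}| = (2 ^ (s * n.+1) * 2 ^ (s * n.+1))%N.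
Proof. by rewrite !card_ffun !card_ord -expnM -expnMn mulnC. Qed.

(** Sums of signs multiply, so v - 2 k is a power of the value 2 for {0} in Z_4, and it is also the
    square root of v. *)
Lemma card_grid_set : (#|grid_set| * 2 + 2 ^ (s * n.+1) = #|{ffun 'I_s -> axis}|)%N.
Proof.
have:= sum_sign_fun grid_set.
rewrite !sum_sign_fun_odd_power sum_sign_fun_Z4 !card_ord -exprM mulnC.
have -> : (2 : int) ^+ (s * n.+1) = (2 ^ (s * n.+1))%N%:Z.
  by rewrite -[RHS]natz natrX.
by move=> sumE; apply/eqP; rewrite -eqz_nat PoszD sumE addrC subrK.
Qed.

Lemma grid_root_ge4 : (4 <= 2 ^ (s * n.+1))%N.
Proof. by rewrite (@leq_exp2l 2 2) //; nia. Qed.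

(** With v = u^2, 2 k = u^2 - u and u >= 4, one gets 4 k - v = u (u - 2) > 0 and k >= 6. *)
Lemma grid_set_bounds :
  [/\ #|{ffun 'I_s -> axis}| < 4 * #|grid_set|,
      #|grid_set| < #|{ffun 'I_s -> axis}|, 4 < #|{ffun 'I_s -> axis}|
    & 2 < #|grid_set|]%N.
Proof.
have:= card_grid_set; have:= grid_root_ge4; rewrite card_grid.
by split; nia.
Qed.

Definition grid_design : design2.
refine (@translate_design _ grid_set menon_grid_set _ _).
all: by case: grid_set_bounds.
Defined.

Lemma grid_design_nontrivial : nontrivial grid_design.
Proof. by apply: translate_design_nontrivial; case: grid_set_bounds. Qed.

Lemma grid_design_grid_imprimitive :
  block_transitive_grid_imprimitive s grid_design.
Proof.
exists (translation_group {ffun 'I_s -> axis}).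
have trH := translates_transitive grid_set.
split; [exact: (atrans_acts trH) | exact: trH | split=> //].
exists (fun _ => axis); split=> [i|].
  by rewrite card_ffun !card_ord expnS (leq_trans _ (leq_pmulr _ _)) ?expn_gt0.
(* Points are already functions on ['I_s]; translation by [t] acts on coordinate [i] as translation
   by [t i]. *)
exists id; first by exists id.
move=> _ /imsetP[t _ ->]; exists (fun i => translation (t i)) => x i.
by rewrite !permE ffunE.
Qed.

End MenonGrid.

Theorem theorem1p4 :
  (exists D : nat -> design2,
     (forall n : nat,
        nontrivial (D n) /\ block_transitive_grid_imprimitive 3 (D n)) /\
     (forall m n : nat, m <> n -> ~ isomorphic (D m) (D n))) /\
  (exists D : design2,
     nontrivial D /\ block_transitive_grid_imprimitive 4 D).
Proof.
split; last first.
  exists (@grid_design 4 0 isT); split; first exact: grid_design_nontrivial.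
  exact: grid_design_grid_imprimitive.
exists (fun n => @grid_design 3 n isT); split=> [n|m n m_neq_n [f f_bij _]].
  by split; [exact: grid_design_nontrivial | exact: grid_design_grid_imprimitive].
(* The number of points, 2 ^ (6 (n + 1)), already separates the designs. *)
have /eqP := bij_eq_card f_bij.
rewrite [X in X == _](card_grid 3 m) [X in _ == X](card_grid 3 n).
by rewrite -!expnD eqn_exp2l // => /eqP; lia.
Qed.
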